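(* Let $X$ be a countable semilattice and $\ell:\operatorname{dom}(\ell)\to X$ a function defined on a countable subset $\operatorname{dom}(\ell)\subset X^\omega$. The following conditions are equivalent: (1) The semilattice $X$ admits a shift-continuous metrizable topology $\tau$ in which every sequence $s\in\operatorname{dom}(\ell)$ converges to the point $\ell(s)$. (2) The semilattice $X$ admits a shift-continuous Hausdorff topology $\tau$ in which every sequence $s\in\operatorname{dom}(\ell)$ converges to the point $\ell(s)$. (3) The following two conditions hold: (3a) for any $s\in\operatorname{dom}(\ell)$, $a\in X$ and $x\in X$ with $x\ne a\cdot\ell(s)$ the set $\{n\in\omega:a\cdot s_n=x\}$ is finite; (3b) for any $s,t\in\operatorname{dom}(\ell)$ and $a,b\in X$ with $a\cdot\ell(s)\ne b\cdot\ell(t)$ there exists a finite set $F\subset\omega$ such that $a\cdot s_n\ne b\cdot t_m$ for any $n,m\in\omega\setminus F$.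
   Context: $X^\omega$ is the set of all sequences $s=(s_n)_{n\in\omega}$ of elements of $X$. A semilattice is a commutative semigroup all of whose elements are idempotents ($xx=x$). A topology $\tau$ on a semilattice $X$ is shift-continuous if for every $a\in X$ the map $X\to X$, $x\mapsto ax$, is continuous with respect to $\tau$. *)

(* Defs.v *)
From HB Require Import structures.
From mathcomp Require Import all_boot all_order all_algebra.
From mathcomp Require Import all_classical all_reals all_analysis.

Set Implicit Arguments.
Unset Strict Implicit.
Unset Printing Implicit Defensive.

Local Open Scope classical_set_scope.

HB.mixin Record Semigroup_isSemilattice X & Semigroup X := {
  mulsC : forall x y : X, (x * y)%g = (y * x)%g ;
  mulss : forall x : X, (x * x)%g = x
}.

#[short(type="semilatticeType")]
HB.structure Definition Semilattice :=
  { X of Semigroup X & Semigroup_isSemilattice X }.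

Record topology (X : Type) := Topology {
  opens : set_system X ;
  opensT : opens setT ;
  opensI : setI_closed opens ;
  opens_bigU : forall (I : Type) (f : I -> set X), (forall i, opens (f i)) ->
    opens (\bigcup_i f i)
}.

(* The type [X] carrying the library's [topologicalType] structure whose open
   sets are those of [tau]; the choice structure is classical and plays no
   role. *)
Definition topologized (X : Type) (tau : topology X) : Type := X.

HB.instance Definition _ X (tau : topology X) := gen_eqMixin (topologized tau).
HB.instance Definition _ X (tau : topology X) :=
  gen_choiceMixin (topologized tau).
HB.instance Definition _ X (tau : topology X) :=
  isOpenTopological.Build (topologized tau)
    (opensT tau) (@opensI _ tau) (@opens_bigU _ tau).

Lemma open_topologized (X : Type) (tau : topology X) :
  @open (topologized tau) = opens tau.
Proof. by []. Qed.

Definition shift_continuous (X : semigroupType) (tau : topology X) : Prop :=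
  forall a : X,
    continuous ((fun x => (a * x)%g) : topologized tau -> topologized tau).

Definition hausdorff (X : Type) (tau : topology X) : Prop :=
  hausdorff_space (topologized tau).

(* [tau] is the topology of a metric on [X]: as [metricType] bundles its own
   carrier, this is phrased as a homeomorphism onto a metric space. *)
Definition metrizable (R : realType) (X : Type) (tau : topology X) : Prop :=
  exists (M : metricType R) (f : topologized tau -> M)
      (g : M -> topologized tau),
    [/\ cancel f g, cancel g f, continuous f & continuous g].

Definition converges_to (X : Type) (tau : topology X) (s : nat -> X) (x : X) :
  Prop := (s : nat -> topologized tau) @ \oo --> (x : topologized tau).

(* Main.v *)
(** Since [zz = z], distinct points of a semilattice are separated by a shift,
so it is enough to find a countable family of two-valued functions [f] that
separates the points of [X] and satisfies [f (a * s_n) = f (a * ell s)] for all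
large [n]. The topology induced by the functions [fun z => f (a * z)] is then
metrizable, shift-continuous and makes every [s] converge to [ell s].

To separate [x] from [y], start from [{x}] and [{y}] and enlarge two disjoint
sets alternately, keeping each of them closed under the limits of the sequences
[a * s_n]. At every step one more limit point, together with a tail of its
sequence, is absorbed by one of the two sets. *)
Require Import Defs.
From HB Require Import structures.
From mathcomp Require Import all_boot all_order all_algebra.
From mathcomp Require Import all_classical all_reals all_analysis.

Set Implicit Arguments.
Unset Strict Implicit.
Unset Printing Implicit Defensive.

Import Order.TTheory GRing.Theory Num.Theory.

Local Open Scope classical_set_scope.
Local Open Scope group_scope.

Lemma countable_code (T : Type) (A : set T) :
  countable A -> exists c : A -> nat, injective c.
Proof.
move=> /countable_injP[c cinj]; exists (c \o set_val) => x y cxy.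
by apply: val_inj; apply: (cinj _ _ _ _ cxy); apply: valP.
Qed.

Lemma finite_set_near (A : set nat) :
  finite_set A <-> \forall n \near \oo, ~ A n.
Proof.
split=> [Afin|[N _ AN]]; last first.
  apply: (@sub_finite_set _ _ `I_N) (finite_II N) => n An /=.
  by rewrite ltnNge; apply/negP => /AN.
have /finite_seqP[s ->] := Afin.
exists (\max_(i <- s) i).+1 => // n /= sn ns.
by have := @leq_bigmax_seq _ s xpredT id n ns isT; rewrite leqNgt sn.
Qed.

(** A copy of [T] that records the data of the metric put on it below, so that the metric instance
    can be inferred from the type. *)
Definition family_space (R : realType) (T I : Type) (F : I -> T -> bool)
  (code : I -> nat) (_ : forall x y, (forall i, F i x = F i y) -> x = y) :
  Type := T.

(** * The metric of a countable separating family of two-valued functions *)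

Section FamilyMetric.
Local Open Scope ring_scope.
Context (R : realType) (T I : Type) (F : I -> T -> bool) (code : I -> nat).

Definition agree (N : nat) (x y : T) : Prop :=
  forall i, (code i <= N)%N -> F i x = F i y.

Lemma agree_le M N x y : (M <= N)%N -> agree N x y -> agree M x y.
Proof. by move=> MN xy i iM; apply: xy; apply: leq_trans MN. Qed.

(** The first-difference ultrametric, as on Cantor space: the minimum is the least code of an index
    at which [x] and [y] differ. *)
Definition agree_dist (x y : T) : R :=
  if pselect (exists N, ~~ `[< agree N x y >]) is left e
  then (ex_minn e).+1%:R^-1 else 0.

Lemma agree_distP x y : agree_dist x y = 0 \/
  exists2 N, agree_dist x y = N.+1%:R^-1 & ~ agree N x y.
Proof.
rewrite /agree_dist; case: pselect => [e|_]; last by left.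
by right; case: ex_minnP => N /asboolPn NE _; exists N.
Qed.

Lemma agree_dist_lt x y N : (agree_dist x y < N.+1%:R^-1) <-> agree N x y.
Proof.
rewrite /agree_dist; case: pselect => [e|ne].
  case: ex_minnP => m /asboolPn mE mmin.
  rewrite ltf_pV2 ?posrE// ltr_nat ltnS; split=> [Nm|NE].
    by apply: contrapT => /asboolPn /mmin; rewrite leqNgt Nm.
  by rewrite ltnNge; apply/negP => mN; apply: mE; apply: agree_le NE.
split=> [_|_]; last by rewrite invr_gt0.
by apply: contrapT => /asboolPn xyN; apply: ne; exists N.
Qed.

Lemma agree_dist_ge0 x y : 0 <= agree_dist x y.
Proof. by have [->//|[N -> _]] := agree_distP x y; rewrite invr_ge0. Qed.

Lemma agree_distxx x : agree_dist x x = 0.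
Proof. by have [->//|[N _]] := agree_distP x x; case. Qed.

Lemma agree_dist_le x y z t :
  (forall N, agree N x y -> agree N z t) -> agree_dist z t <= agree_dist x y.
Proof.
move=> E; have [->|[N -> nE]] := agree_distP z t; first exact: agree_dist_ge0.
by rewrite leNgt; apply/negP => /agree_dist_lt /E.
Qed.

Lemma agree_dist_sym x y : agree_dist x y = agree_dist y x.
Proof.
by apply/eqP; rewrite eq_le !agree_dist_le// => N xy i iN; rewrite xy.
Qed.

(** Agreement up to a given code is transitive, so one of the two summands alone is already at least
    [agree_dist x z]. *)
Lemma agree_dist_triangle y x z :
  agree_dist x z <= agree_dist x y + agree_dist y z.
Proof.
have [->|[N -> nE]] := agree_distP x z; first by rewrite addr_ge0 ?agree_dist_ge0.
have [xy|] := ltP (agree_dist x y) N.+1%:R^-1; last first.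
  by move=> ?; rewrite (le_trans (y := agree_dist x y))// lerDl agree_dist_ge0.
have [yz|] := ltP (agree_dist y z) N.+1%:R^-1; last first.
  by move=> ?; rewrite (le_trans (y := agree_dist y z))// lerDr agree_dist_ge0.
case: nE => i iN; move/agree_dist_lt: xy => ->//; move/agree_dist_lt: yz; exact.
Qed.

Hypothesis F_separates : forall x y, (forall i, F i x = F i y) -> x = y.

Lemma agree_dist_positivity x y : agree_dist x y = 0 -> x = y.
Proof.
move=> xy0; apply: F_separates => i.
by have /agree_dist_lt : agree_dist x y < (code i).+1%:R^-1;
  [rewrite xy0 invr_gt0|apply].
Qed.

Local Notation family_space := (family_space R code F_separates).

HB.instance Definition _ := gen_eqMixin family_space.
HB.instance Definition _ := gen_choiceMixin family_space.
HB.instance Definition _ := @isMetric.Build R family_space agree_dist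
  agree_distxx agree_dist_positivity agree_dist_sym agree_dist_triangle.

Hypothesis code_inj : injective code.

Lemma family_cvgP (S : Type) (G : set_system S) (FG : Filter G)
    (g : S -> family_space) (x : family_space) :
  g @ G --> x <-> forall i, \forall t \near G, F i (g t) = F i x.
Proof.
split=> [/cvg_ballP gx i|gx].
  have e0 : (0 : R) < (code i).+1%:R^-1 by rewrite invr_gt0.
  apply: filterS (gx _ e0) => t; rewrite ballEmdist/= => /agree_dist_lt.
  by move=> ->.
apply/cvg_ballP => e e0.
have [N _ /(_ N (leqnn N)) Ne] := near_infty_natSinv_lt (PosNum e0).
(* Agreement up to code [N] puts [g t] in the ball. This involves finitely many codes, each carried
   by at most one index, so a finite intersection of sets of the filter suffices. *)
suff : \forall t \near G, forall k : 'I_N.+1, forall i, code i = k ->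
    F i x = F i (g t).
  apply: filterS => t xt; rewrite ballEmdist/=; apply: lt_trans Ne.
  by apply/agree_dist_lt => i; rewrite -ltnS => iN; exact: (xt (Ordinal iN)).
apply: filter_forall => k.
have [[i ik]|nk] := pselect (exists i, code i = k).
  by apply: filterS (gx i) => t tx j; rewrite -ik => /code_inj ->.
by apply: filterE => t i ik; case: nk; exists i.
Qed.

End FamilyMetric.

(** The filter is arbitrary because both uses matter later: neighbourhood filters for the continuity
    of shifts, and sequences. *)
Lemma metrizable_of_family (R : realType) (T I : Type) (F : I -> T -> bool)
    (code : I -> nat) :
  injective code -> (forall x y, (forall i, F i x = F i y) -> x = y) ->
  exists2 tau : topology T, metrizable R tau &
    forall (S : Type) (G : set_system S) (FG : Filter G)
      (g : S -> topologized tau) (x : topologized tau),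
      g @ G --> x <-> forall i, \forall t \near G, F i (g t) = F i x.
Proof.
move=> code_inj Fsep.
pose M : metricType R := family_space R code Fsep.
pose tau : topology T := @Topology T (@open M) (@openT M) (@openI M)
  (fun J f fo => @bigcup_open M J setT f (fun i _ => fo i)).
exists tau.
  exists M, id, id; split=> //; apply/continuousP => A //.
move=> S G FG g x; rewrite -(@family_cvgP R T I F code Fsep code_inj S G FG).
suff -> : nbhs (x : topologized tau) = nbhs (x : M) by [].
by rewrite !nbhsE.
Qed.

Lemma metrizable_hausdorff (R : realType) (X : Type) (tau : topology X) :
  metrizable R tau -> hausdorff tau.
Proof.
move=> [M [f [g [fK gK fc gc]]]] p q pq; apply: (can_inj fK).
apply: (@metric_hausdorff R M) => A B fA fB.
have [z [Az Bz]] := pq _ _ (fc _ _ fA) (fc _ _ fB).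
by exists (f z).
Qed.

(** * Separating two points compatibly with countably many prescribed limits *)

Section ClopenSeparation.
Context (X I : Type) (code : I -> nat) (u : I -> nat -> X) (p : I -> X).
Hypothesis code_inj : injective code.
Hypothesis u_separated : forall i j, p i <> p j ->
  exists N, forall n m, (N <= n)%N -> (N <= m)%N -> u i n <> u j m.
Hypothesis u_constant : forall x, exists2 i, p i = x & forall n, u i n = x.

(** Sequential closedness in contrapositive form: if [u i] visits [A] infinitely often, then [p i]
    lies in [A]. *)
Definition limit_closed (A : set X) : Prop :=
  forall i, ~ A (p i) -> \forall n \near \oo, ~ A (u i n).

Lemma u_neq i x : p i <> x -> \forall n \near \oo, u i n <> x.
Proof.
have [j <- uj] := u_constant x => /u_separated[N uN].
by exists N => // n Nn; rewrite -(uj N); apply: uN.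
Qed.

Lemma limit_closed1 x : limit_closed [set x].
Proof. by move=> i /= /u_neq. Qed.

Lemma absorb_sequence i (A B : set X) :
  limit_closed A -> limit_closed B -> A `&` B = set0 -> ~ B (p i) ->
  exists A', [/\ limit_closed A', A `<=` A', A' `&` B = set0, A' (p i) &
    \forall n \near \oo, A' (u i n)].
Proof.
move=> Acl Bcl AB0 Bpi; have [N _ uB] := Bcl _ Bpi.
(* From [N] on, [u i] avoids [B], so starting the tail there preserves disjointness. *)
exists (A `|` [set p i] `|` [set u i n | n in [set n | (N <= n)%N]]); split.
- move=> j /= pj.
  have [Apj pji] : ~ A (p j) /\ p j <> p i by tauto.
  have [K uK] := u_separated pji.
  have pju m : (N <= m)%N -> p j <> u i m.
    by move=> Nm E; apply: pj; right; exists m.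
  (* [K] separates [u j] only from the terms of [u i] of index at least [K]. The earlier tail terms
     are finitely many points other than [p j], and each is eventually avoided. *)
  have head : \forall n \near \oo, forall m : 'I_K, (N <= m)%N -> u j n <> u i m.
    apply: filter_forall => m; have [Nm|_] := leqP N m; last exact: filterE.
    by apply: filterS (u_neq (pju _ Nm)).
  near=> n => /= -[[An|un]|[m /= Nm un]].
  + by move: An; near: n; exact: Acl.
  + by move: un; near: n; exact: u_neq.
  + have [Km|mK] := leqP K m.
      by apply: (uK n m) => //; near: n; exact: nbhs_infty_ge.
    have H : forall m : 'I_K, (N <= m)%N -> u j n <> u i m by near: n.
    exact: (H (Ordinal mK)) Nm (esym un).
- by move=> x Ax; left; left.
- rewrite -subset0 => x [[[Ax|->//]|[n /= Nn <-]] Bx]; last exact: uB Nn Bx.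
  by rewrite -AB0; split.
- by left; right.
- by exists N => // n /= Nn; right; exists n.
Unshelve. all: by end_near.
Qed.

Definition disjoint_closed (AB : set X * set X) : Prop :=
  [/\ limit_closed AB.1, limit_closed AB.2 & AB.1 `&` AB.2 = set0].

Definition sub_pair (AB AB' : set X * set X) : Prop :=
  AB.1 `<=` AB'.1 /\ AB.2 `<=` AB'.2.

Definition absorbs (A : set X) i : Prop :=
  A (p i) /\ \forall n \near \oo, A (u i n).

(** By disjointness [p i] is missing from one of the two sets, and the other can absorb. The
    hypothesis sits under the existential so that [choice] gives a step function defined on all
    pairs. *)
Lemma absorb_step i AB : exists AB', disjoint_closed AB ->
  [/\ disjoint_closed AB', sub_pair AB AB' &
      absorbs AB'.1 i \/ absorbs AB'.2 i].
Proof.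
have [dAB|] := pselect (disjoint_closed AB); last by exists AB.
case: AB dAB => A B [/= Acl Bcl AB0].
have [Bpi|Bpi] := pselect (B (p i)); last first.
  have [A' [A'cl AA' A'B0 A'pi A'u]] := absorb_sequence Acl Bcl AB0 Bpi.
  by exists (A', B) => _; split=> [||]; [split| split|left].
have Api : ~ A (p i) by move=> Api; rewrite -[False]/(set0 (p i)) -AB0.
have [|B' [B'cl BB' B'A0 B'pi B'u]] := absorb_sequence Bcl Acl _ Api.
  by rewrite setIC.
by exists (A, B') => _; split=> [||]; [split=> //=; rewrite setIC|split|right].
Qed.

Lemma clopen_separation x y : x <> y -> exists f : X -> bool,
  [/\ f x, ~~ f y & forall i, \forall n \near \oo, f (u i n) = f (p i)].
Proof.
move=> xy; have [i0 _ _] := u_constant x.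
(* [e] is a left inverse of [code], with default [i0] off its range; stage [n.+1] below treats the
   index [e n]. *)
have /choice[e eK] n : exists i, forall j, code j = n -> i = j.
  have [[j jn]|nj] := pselect (exists j, code j = n).
    by exists j => k; rewrite -jn => /code_inj.
  by exists i0 => j jn; case: nj; exists j.
have [step stepP] := choice (fun q => absorb_step q.1 q.2).
pose st := fix st n : set X * set X :=
  if n is m.+1 then step (e m, st m) else ([set x], [set y]).
have st_closed n : disjoint_closed (st n).
  elim: n => [|n IHn]; last by have [] := stepP (e n, st n) IHn.
  split; [exact: limit_closed1..|].
  by rewrite -subset0 => z [/= -> /xy].
have st_le : {homo st : m n / (m <= n)%N >-> sub_pair m n}.
  apply: homo_leq => [AB|B A C [AB1 AB2] [BC1 BC2]|n].
  - by split.
  - by split=> z; [move/AB1/BC1|move/AB2/BC2].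
  - by have [] := stepP (e n, st n) (st_closed n).
have st_disj m n z : (st m).1 z -> (st n).2 z -> False.
  have [le1 _] := st_le _ _ (leq_maxl m n); have [_ le2] := st_le _ _ (leq_maxr m n).
  move=> /le1 z1 /le2 z2; have [_ _ st0] := st_closed (maxn m n).
  by rewrite -[False]/(set0 z) -st0.
exists (fun z => `[< exists n, (st n).1 z >]); split=> [||i].
- by apply/asboolP; exists 0%N.
- by apply/asboolPn => -[n /st_disj]; apply; exact: (erefl : (st 0%N).2 y).
(* Index [i] is absorbed at stage [(code i).+1]. If the second set absorbs it, disjointness across
   stages makes [f] false at [p i] and on a tail of [u i]. *)
have [_ _] := stepP (e (code i), st (code i)) (st_closed _).
rewrite /= -[step _]/(st (code i).+1) (eK _ i)// => -[[pi ui]|[pi ui]].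
  apply: filterS ui => n ui.
  by apply/asboolP/asboolP => _; exists (code i).+1.
apply: filterS ui => n ui.
by apply/asboolP/asboolP => -[m /st_disj]; [move/(_ _ ui)|move/(_ _ pi)].
Qed.

End ClopenSeparation.

(** The shifts by [z] and [w] suffice: z = zz = zw = wz = ww = w. *)
Lemma semilattice_separated (X : semilatticeType) (z w : X) :
  (forall a, a * z = a * w) -> z = w.
Proof. by move=> zw; rewrite -[z]mulss zw mulsC zw mulss. Qed.

(** * Necessity and sufficiency of the separation conditions *)

Section Separation.
Context (R : realType) (X : semilatticeType) (dom : set (nat -> X)).
Context (ell : dom -> X).

Lemma hausdorff_separation (tau : topology X) :
  shift_continuous tau -> hausdorff tau ->
  (forall s : dom, converges_to tau (set_val s) (ell s)) ->
  (forall (s : dom) (a x : X), x <> a * ell s ->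
     finite_set [set n | a * set_val s n = x]) /\
  (forall (s t : dom) (a b : X), a * ell s <> b * ell t ->
     exists2 F : set nat, finite_set F &
       forall n m : nat, ~ F n -> ~ F m -> a * set_val s n <> b * set_val t m).
Proof.
move=> shift haus conv.
have cvgM (s : dom) (a : X) (U : set (topologized tau)) :
    nbhs (a * ell s : topologized tau) U ->
    \forall n \near \oo, U (a * set_val s n).
  by move=> /(shift a (ell s)) /(conv s).
have sep (x y : X) : x <> y -> exists U V : set (topologized tau),
    [/\ nbhs (x : topologized tau) U, nbhs (y : topologized tau) V &
        U `&` V = set0].
  move=> xy; apply: contrapT => nUV; apply: xy; apply: haus => U V xU yV.
  by apply/set0P/eqP => UV0; apply: nUV; exists U, V.
split=> [s a x /sep[U [V [xU sV UV0]]]|s t a b /sep[U [V [sU tV UV0]]]].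
  apply/finite_set_near; apply: filterS (cvgM _ _ _ sV) => n Vn /= nx.
  rewrite -[False]/(set0 x) -UV0; split; last by rewrite -nx.
  exact: nbhs_singleton xU.
(* Outside this set both shifted sequences lie in their neighbourhoods; it is finite because both
   converge. *)
exists [set n | ~ (U (a * set_val s n) /\ V (b * set_val t n))].
  apply/finite_set_near; near=> n; move=> /=; apply; split; near: n; exact: cvgM.
move=> n m /contrapT[Un _] /contrapT[_ Vm] E.
by rewrite -[False]/(set0 (a * set_val s n)) -UV0; split; rewrite // E.
Unshelve. all: by end_near.
Qed.

Lemma metrizable_of_separation :
  countable [set: X] -> countable dom ->
  (forall (s : dom) (a x : X), x <> a * ell s ->
     finite_set [set n | a * set_val s n = x]) ->
  (forall (s t : dom) (a b : X), a * ell s <> b * ell t ->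
     exists2 F : set nat, finite_set F &
       forall n m : nat, ~ F n -> ~ F m ->
         a * set_val s n <> b * set_val t m) ->
  exists tau : topology X,
    [/\ shift_continuous tau, metrizable R tau &
        forall s : dom, converges_to tau (set_val s) (ell s)].
Proof.
move=> /countable_injP[cX cX_inj] /countable_code[cD cD_inj] fin disj.
have {}cX_inj : injective cX by move=> x y; apply: cX_inj; rewrite in_setT.
(* Left indices stand for constant sequences, right ones for the shifts of the sequences in
   [dom]. *)
pose code (i : X + X * dom) : nat := pickle (match i with
  | inl x => inl (cX x) | inr (a, s) => inr (cX a, cD s) end : nat + nat * nat).
have code_inj : injective code.
  move=> i j /(pcan_inj pickleK).
  case: i j => [x|[a s]] [y|[b t]] //= [].
    by move=> /cX_inj ->.
  by move=> /cX_inj -> /cD_inj ->.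
pose u (i : X + X * dom) n :=
  match i with inl x => x | inr (a, s) => a * set_val s n end.
pose p (i : X + X * dom) :=
  match i with inl x => x | inr (a, s) => a * ell s end.
have u_sep i j : p i <> p j ->
    exists N, forall n m, (N <= n)%N -> (N <= m)%N -> u i n <> u j m.
  have inlr (x a : X) (s : dom) : x <> a * ell s ->
      exists N, forall n, (N <= n)%N -> a * set_val s n <> x.
    by move=> /fin/finite_set_near[N _ xN]; exists N.
  case: i j => [x|[a s]] [y|[b t]] /= E.
  - by exists 0%N.
  - by have [N xN] := inlr _ _ _ E; exists N => n m _ /xN/nesym.
  - by have [N yN] := inlr _ _ _ (nesym E); exists N => n m /yN.
  - have [F /finite_set_near[N _ FN] EF] := disj _ _ _ _ E.
    by exists N => n m /FN Fn /FN Fm; apply: EF.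
have u_cst x : exists2 i, p i = x & forall n, u i n = x by exists (inl x).
have /choice[f fP] (xy : X * X) : exists f : X -> bool,
    (xy.1 <> xy.2 -> f xy.1 /\ ~~ f xy.2) /\
    forall i, \forall n \near \oo, f (u i n) = f (p i).
  case: xy => x y /=; have [<-|xy] := pselect (x = y).
    by exists xpredT; split=> // i; apply: filterE.
  by have [f [fx fy fu]] := clopen_separation code_inj u_sep u_cst xy; exists f.
(* Composing with all shifts makes the family separate points and closes it under further shifts. *)
pose F (i : X * (X * X)) z := f i.2 (i.1 * z).
pose cF (i : X * (X * X)) := pickle (cX i.1, (cX i.2.1, cX i.2.2)).
have cF_inj : injective cF.
  move=> [a [x y]] [b [z t]] /(pcan_inj pickleK)[].
  by move=> /cX_inj-> /cX_inj-> /cX_inj->.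
have F_sep z w : (forall i, F i z = F i w) -> z = w.
  move=> zw; apply: semilattice_separated => a; apply: contrapT => azw.
  have [/(_ azw)[fz fw] _] := fP (a * z, a * w).
  by have := zw (a, (a * z, a * w)); rewrite /F /= fz (negbTE fw).
have [tau tau_metr tauP] := metrizable_of_family R cF_inj F_sep.
exists tau; split=> // [a x|s].
(* The function of index [(b, xy)] after the shift by [a] is the member of index [(b * a, xy)],
   which is eventually constant along the neighbourhoods of [x]. *)
- apply/(tauP _ _ (nbhs_filter (x : topologized tau))) => -[b xy].
  have /(tauP _ _ (nbhs_filter _))/(_ (b * a, xy)) :
    (y : topologized tau) @[y --> x] --> x by [].
  by apply: filterS => y; rewrite /F /= !mulgA.
- apply/tauP => -[a xy]; rewrite /F /=.
  by have [_ /(_ (inr (a, s)))] := fP xy.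
Qed.

End Separation.

Theorem theorem5p1 (R : realType) (X : semilatticeType)
    (countX : countable [set: X])
    (dom : set (nat -> X)) (countdom : countable dom) (ell : dom -> X) :
  [<-> exists tau : topology X,
         [/\ shift_continuous tau, metrizable R tau &
             forall s : dom, converges_to tau (set_val s) (ell s)];
       exists tau : topology X,
         [/\ shift_continuous tau, hausdorff tau &
             forall s : dom, converges_to tau (set_val s) (ell s)];
       (forall (s : dom) (a x : X), x <> a * ell s ->
          finite_set [set n | a * set_val s n = x]) /\
       (forall (s t : dom) (a b : X), a * ell s <> b * ell t ->
          exists2 F : set nat, finite_set F &
            forall n m : nat, ~ F n -> ~ F m ->
              a * set_val s n <> b * set_val t m)].
Proof.
tfae.
- by move=> [tau [shift /metrizable_hausdorff haus conv]]; exists tau.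
- by move=> [tau [shift haus conv]]; exact: hausdorff_separation shift haus conv.
- by move=> [fin disj]; exact: metrizable_of_separation.
Qed.
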